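(* Let $\{x^t\}$ be generated by Algorithm 1 (described in the context) for $\min_xF(x)$, $F=f+P$. Then for all $t\ge1$, $$F(x^t)-F(x^* )\le\min\left\{\left(1-\sqrt{\mu\min\{\gamma_0,\delta L_{\widehat{\mathcal S}}^{-1}\}}\right)^{t-1},\;4\left(2+(t-1)\alpha_0\sqrt{\min\{1,\delta\gamma_0^{-1}L_{\widehat{\mathcal S}}^{-1}\}}\right)^{-2}\right\}r_0^2 .$$
   Context: Problem. $f,P:\mathbb R^n\to(-\infty,\infty]$ are proper closed convex functions, $f$ is differentiable on $\mathrm{cl}(\mathrm{dom}(P))$, and $\nabla f$ is locally Lipschitz continuous on $\mathrm{cl}(\mathrm{dom}(P))$; $\mathrm{dom}(P)$ may be unbounded. (A map $\nabla h$ is locally Lipschitz continuous on $\Omega$ if for every $x\in\Omega$ there are $L_x>0$ and an open set $U_x\ni x$ such that $\nabla h$ is $L_x$-Lipschitz continuous on $U_x$.) $F=f+P$, $F^*=\min_xF(x)\in\mathbb R$ is attained, and $x^*$ is an arbitrary fixed minimizer of $F$. $\mu\ge0$ is the convexity parameter of $f$ on $\mathrm{dom}(P)$: $f(y)\ge f(x)+\langle\nabla f(x),y-x\rangle+\frac\mu2\|x-y\|^2$ for all $x\in\mathrm{dom}(P)$, $y\in\mathbb R^n$. The proximal operator of $P$ can be evaluated exactly. $\|\cdot\|$ is the Euclidean norm. Algorithm 1. Input: $\gamma_0\in(0,1/\mu]$ (with $1/0=\infty$, so $\gamma_0$ is any positive number if $\mu=0$), $0<\alpha_0\in[\sqrt{\mu\gamma_0},1]$,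 $\delta\in(0,1)$, $x^1=z^1\in\mathrm{dom}(P)$. For $t=1,2,\dots$ compute $y^t=\big((1-\alpha_t)x^t+\alpha_t(1-\beta_t)z^t\big)/(1-\alpha_t\beta_t)$, $z^{t+1}=\arg\min_x\{\gamma_t[\langle\nabla f(y^t),x\rangle+P(x)]+\frac{\alpha_t}2\|x-\beta_ty^t-(1-\beta_t)z^t\|^2\}$, $x^{t+1}=(1-\alpha_t)x^t+\alpha_tz^{t+1}$, where $\gamma_t=\gamma_0\delta^{n_t}$, $\beta_t=\mu\gamma_t\alpha_t^{-1}$, $\alpha_t\in(0,1]$ is the solution of $\gamma_{t-1}\alpha_t^2=(1-\alpha_t)\alpha_{t-1}^2\gamma_t+\mu\alpha_t\gamma_t\gamma_{t-1}$, and $n_t$ is the smallest non-negative integer such that $2\gamma_t\big(f(x^{t+1})-f(y^t)-\langle\nabla f(y^t),x^{t+1}-y^t\rangle\big)\le\|x^{t+1}-y^t\|^2$. Constants. $r_0=\sqrt{F(x^1)-F(x^* )+\frac{\alpha_0^2}{2\gamma_0}\|x^1-x^*\|^2}$; $\mathcal S=\{x\in\mathrm{dom}(P):\|x-x^*\|\le\sqrt{2\gamma_0}\,r_0/\alpha_0\}$; $L_{\mathcal S}>0$ is a Lipschitz constant of $\nabla f$ on $\mathcal S$ (it exists); $\widehat{\mathcal S}=\{x\in\mathrm{dom}(P):\|x-x^*\|\le(1+\gamma_0L_{\mathcal S})\sqrt{2\gamma_0}\,r_0/\alpha_0\}$; $L_{\widehat{\mathcal S}}>0$ is a Lipschitz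 constant of $\nabla f$ on $\widehat{\mathcal S}$ (it exists). *)

(* Defs.v *)
From HB Require Import structures.
From mathcomp Require Import all_boot all_order all_algebra.
From mathcomp Require Import all_classical all_reals all_analysis.

Set Implicit Arguments.
Unset Strict Implicit.
Unset Printing Implicit Defensive.

Import Order.TTheory GRing.Theory Num.Theory.
Import numFieldNormedType.Exports.

Local Open Scope classical_set_scope.
Local Open Scope ring_scope.

(* The canonical norm of 'rV[R]_n is the sup norm; it induces the usual topology
   and the usual notion of differentiability, but every quantitative estimate
   below is in terms of the Euclidean inner product and norm. *)
Definition dotv (R : realType) (n : nat) (u v : 'rV[R]_n) : R :=
  \sum_(i < n) u 0 i * v 0 i.

Definition enorm (R : realType) (n : nat) (u : 'rV[R]_n) : R :=
  Num.sqrt (dotv u u).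

Section ExtendedValuedFunctions.
Variables (R : realType) (n : nat).
Implicit Types (h : 'rV[R]_n -> \bar R) (A : set 'rV[R]_n).

Definition edom h : set 'rV[R]_n := [set x | (h x < +oo)%E].

Definition proper_fun h : Prop :=
  (forall x, (-oo < h x)%E) /\ edom h !=set0.

Definition closed_fun h : Prop :=
  closed [set p : 'rV[R]_n * R | (h p.1 <= p.2%:E)%E].

(* For functions that never take the value -oo, which is the only use. The
   convention 0 * +oo = 0 makes the cases l = 0 and l = 1 trivial. *)
Definition convex_fun h : Prop :=
  forall (x y : 'rV[R]_n) (l : R), 0 <= l <= 1 ->
    (h (l *: x + (1 - l) *: y)%R <= l%:E * h x + (1 - l)%:E * h y)%E.

Definition proper_closed_convex h : Prop :=
  [/\ proper_fun h, closed_fun h & convex_fun h].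

(* Differentiability at x includes finiteness of h around x, so that taking the
   real part of h does not change h near x. *)
Definition ediff h (x : 'rV[R]_n) : Prop :=
  (\forall y \near x, h y \is a fin_num) /\
  differentiable (fine \o h : 'rV[R]_n -> R) x.

(* Meaningful at points where ediff holds. *)
Definition grad h (x : 'rV[R]_n) : 'rV[R]_n :=
  \row_(i < n) 'D_(delta_mx 0 i) (fine \o h : 'rV[R]_n -> R) x.

Definition lipschitz_grad h (L : R) A : Prop :=
  forall x y, A x -> A y -> enorm (grad h x - grad h y) <= L * enorm (x - y).

Definition locally_lipschitz_grad h A : Prop :=
  forall x, A x -> exists (L : R) (U : set 'rV[R]_n),
    [/\ 0 < L, open U, U x, (forall y, U y -> ediff h y)
      & lipschitz_grad h L U].

Definition convexity_parameter h (mu : R) A : Prop :=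
  forall x y, A x ->
    (h x + (dotv (grad h x) (y - x) + mu / 2 * enorm (x - y) ^+ 2)%:E <= h y)%E.

Definition is_argmin h (x : 'rV[R]_n) : Prop := forall u, (h x <= h u)%E.

End ExtendedValuedFunctions.

Section Algorithm.
Variables (R : realType) (n : nat) (f P : 'rV[R]_n -> \bar R).
Variables (mu gamma0 alpha0 delta : R).

(* The quotient is 0/0 exactly when alpha * beta = 1, which can only happen for
   gamma0 = 1/mu and then forces alpha = beta = 1. As y is otherwise a convex
   combination of x and z, any such combination is allowed in this case. *)
Definition extrapolation (alpha beta : R) (x z y : 'rV[R]_n) : Prop :=
  if 1 - alpha * beta == 0 then
    exists2 s : R, 0 <= s <= 1 & y = (1 - s) *: x + s *: z
  else
    y = (1 - alpha * beta)^-1 *: ((1 - alpha) *: x + (alpha * (1 - beta)) *: z).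

Definition prox_objective (gamma alpha beta : R) (y z u : 'rV[R]_n) : \bar R :=
  (gamma%:E * ((dotv (grad f y) u)%:E + P u)
   + (alpha / 2 * enorm (u - beta *: y - (1 - beta) *: z) ^+ 2)%:E)%E.

(* The quantities computed from the state (gammap, alphap, x, z) when the
   stepsize gamma0 * delta ^+ m is tried; x1 and z1 are the next iterates. *)
Record trial (gammap alphap : R) (x z : 'rV[R]_n) (m : nat)
    (gamma alpha beta : R) (y z1 x1 : 'rV[R]_n) : Prop := Trial {
  trial_gamma : gamma = gamma0 * delta ^+ m;
  trial_alpha01 : 0 < alpha <= 1;
  trial_alpha : gammap * alpha ^+ 2 =
    (1 - alpha) * alphap ^+ 2 * gamma + mu * alpha * gamma * gammap;
  trial_beta : beta = mu * gamma * alpha^-1;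
  trial_y : extrapolation alpha beta x z y;
  trial_z : is_argmin (prox_objective gamma alpha beta y z) z1;
  trial_x : x1 = (1 - alpha) *: x + alpha *: z1
}.

Definition accepts (gamma : R) (y x1 : 'rV[R]_n) : Prop :=
  ((2 * gamma)%:E * (f x1 - f y - (dotv (grad f y) (x1 - y))%:E)
   <= (enorm (x1 - y) ^+ 2)%:E)%E.

(* Entry 0 of gamma and alpha is the input; entry 0 of the other sequences is
   irrelevant. *)
Record generated (nn : nat -> nat) (gamma alpha beta : nat -> R)
    (x y z : nat -> 'rV[R]_n) : Prop := Generated {
  gen_gamma0 : gamma 0%N = gamma0;
  gen_alpha0 : alpha 0%N = alpha0;
  gen_init : x 1%N = z 1%N;
  gen_dom : edom P (x 1%N);
  gen_step : forall t, (1 <= t)%N ->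
    trial (gamma t.-1) (alpha t.-1) (x t) (z t) (nn t)
      (gamma t) (alpha t) (beta t) (y t) (z t.+1) (x t.+1);
  gen_accept : forall t, (1 <= t)%N -> accepts (gamma t) (y t) (x t.+1);
  gen_smallest : forall t m, (1 <= t)%N -> (m < nn t)%N ->
    exists (g a b : R) (y' z' x' : 'rV[R]_n),
      trial (gamma t.-1) (alpha t.-1) (x t) (z t) m g a b y' z' x' /\
      ~ accepts g y' x'
}.

End Algorithm.

Definition dom_ball (R : realType) (n : nat) (P : 'rV[R]_n -> \bar R)
    (c : 'rV[R]_n) (r : R) : set 'rV[R]_n :=
  [set x | edom P x /\ enorm (x - c) <= r].

(* Main.v *)
Require Import Defs.
From HB Require Import structures.
From mathcomp Require Import all_boot all_order all_algebra.
From mathcomp Require Import all_classical all_reals all_analysis.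
From mathcomp Require Import ring lra.

Set Implicit Arguments.
Unset Strict Implicit.
Unset Printing Implicit Defensive.

Import Order.TTheory GRing.Theory Num.Theory.
Import numFieldNormedType.Exports.

Local Open Scope classical_set_scope.
Local Open Scope ring_scope.

(** The proof follows the potential
      [F x_{t+1} - F xs + A_t / 2 * |z_{t+1} - xs|^2],
    where [A_t = alpha_t ^+ 2 / gamma_t]. The equation for [alpha_t] says that
    [A_t = (1 - alpha_t) * A_{t-1} + mu * alpha_t], and with these weights every
    iteration multiplies the potential by at most [1 - alpha_t]
    ([potential_step]): the acceptance test bounds [f x_{t+1}] by a quadratic
    model at [y_t], the proximal step minimizes this model up to convex
    combination with [x_t], and its strong convexity ([prox_three_point]) yields
    the new distance term. The initial potential is [r0 ^+ 2], so the gap is at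
    most [r0 ^+ 2] times the product of the factors [1 - alpha_i].

    It remains to bound [alpha_i] from below, which amounts to bounding the step
    sizes. Since [A_t >= (1 - alpha_t) * A_{t-1}], the potential divided by
    [A_t] does not grow, and all iterates stay in the ball of radius [rho] about
    [xs] ([potential_radius]). The minimizer [xs] is a fixed point of the
    proximal gradient map ([minimizer_subgradient]) and proximal maps are
    nonexpansive ([prox_distance]), so each trial point, accepted or not, lies in
    the ball of radius [(1 + gamma0 * LS) * rho] ([trial_radius]). There the
    descent lemma with constant [LShat] accepts every step size up to
    [LShat^-1] ([rejected_gamma]), and the backtracking therefore stops with
    [gamma_t >= min (gamma0, delta / LShat)] ([gamma_lower_bound]).

    The two rates are two readings of [alpha_t ^+ 2 = A_t * gamma_t]: [A_t >= mu]
    gives the geometric one, and [A_t >= A_0 * prod_(i <= t) (1 - alpha_i)] gives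
    the one of order [t ^- 2] ([accelerated_rate]).

    Derivatives enter only through the subgradient inequality
    [f u + <grad f u, v - u> <= f v] and the Lipschitz bounds; even the descent
    lemma is deduced from these. All arguments therefore take place between real
    functions on the domain of [P], where [f] and [P] are finite. *)

(** * Euclidean geometry *)

Section Euclidean.
Variables (R : realType) (n : nat).
Implicit Types (u v w c : 'rV[R]_n) (a s : R).

Lemma dotvC u v : dotv u v = dotv v u.
Proof. by apply: eq_bigr => i _; rewrite mulrC. Qed.

Lemma dotvDl u v w : dotv (u + v) w = dotv u w + dotv v w.
Proof.
by rewrite /dotv -big_split; apply: eq_bigr => i _; rewrite !mxE mulrDl.
Qed.

Lemma dotvZl a u w : dotv (a *: u) w = a * dotv u w.
Proof.
by rewrite /dotv mulr_sumr; apply: eq_bigr => i _; rewrite !mxE mulrA.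
Qed.

Lemma dotvNl u w : dotv (- u) w = - dotv u w.
Proof. by rewrite -scaleN1r dotvZl mulN1r. Qed.

Lemma dotvDr u v w : dotv u (v + w) = dotv u v + dotv u w.
Proof. by rewrite dotvC dotvDl !(dotvC u). Qed.

Lemma dotvZr a u w : dotv u (a *: w) = a * dotv u w.
Proof. by rewrite dotvC dotvZl dotvC. Qed.

Lemma dotvNr u w : dotv u (- w) = - dotv u w.
Proof. by rewrite dotvC dotvNl dotvC. Qed.

Definition dotvE := (dotvDl, dotvDr, dotvZl, dotvZr, dotvNl, dotvNr).

Lemma dotv_ge0 u : 0 <= dotv u u.
Proof. by apply: sumr_ge0 => i _; rewrite -expr2 sqr_ge0. Qed.

Lemma enorm_ge0 u : 0 <= enorm u.
Proof. exact: sqrtr_ge0. Qed.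

Lemma sqr_enorm u : enorm u ^+ 2 = dotv u u.
Proof. exact/sqr_sqrtr/dotv_ge0. Qed.

Lemma enormZ a u : enorm (a *: u) = `|a| * enorm u.
Proof.
rewrite /enorm dotvZl dotvZr mulrA -expr2 sqrtrM ?sqr_ge0 //.
by rewrite sqrtr_sqr.
Qed.

Lemma enormN u : enorm (- u) = enorm u.
Proof. by rewrite -scaleN1r enormZ normrN1 mul1r. Qed.

Lemma enorm_eq0 u v : enorm u = 0 -> dotv u v = 0.
Proof.
move=> u0; apply: big1 => i _.
have /eqP : dotv u u = 0 by rewrite -sqr_enorm u0 expr0n.
rewrite psumr_eq0 => [/allP/(_ i)|j _]; last by rewrite -expr2 sqr_ge0.
by rewrite mem_index_enum -expr2 sqrf_eq0 => /(_ isT)/eqP ->; rewrite mul0r.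
Qed.

Lemma cauchy_schwarz u v : dotv u v <= enorm u * enorm v.
Proof.
have [u0|u0] := eqVneq (enorm u) 0; first by rewrite enorm_eq0 // u0 mul0r.
have [v0|v0] := eqVneq (enorm v) 0.
  by rewrite dotvC enorm_eq0 // v0 mulr0.
have uv0 : 0 < enorm u * enorm v.
  by rewrite mulr_gt0 // lt_def enorm_ge0 ?u0 ?v0.
(* The squared norm of |v| u - |u| v equals 2 |u| |v| (|u| |v| - <u, v>). *)
have := dotv_ge0 (enorm v *: u - enorm u *: v).
rewrite !dotvE (dotvC v u) -!sqr_enorm.
set a := enorm u in uv0 *; set b := enorm v in uv0 *; set d := dotv u v => H.
rewrite -subr_ge0 -(pmulr_rge0 _ uv0).
by lra.
Qed.

Lemma enormD u v : enorm (u + v) <= enorm u + enorm v.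
Proof.
rewrite -(@ler_pXn2r _ 2) // ?nnegrE ?addr_ge0 ?enorm_ge0 //.
rewrite sqrrD !sqr_enorm !dotvE (dotvC v u).
by have := cauchy_schwarz u v; lra.
Qed.

Lemma enorm_distC u v : enorm (u - v) = enorm (v - u).
Proof. by rewrite -enormN opprB. Qed.

Lemma convex_combB s u v c :
  s *: u + (1 - s) *: v - c = s *: (u - c) + (1 - s) *: (v - c).
Proof. by apply/rowP => i; rewrite !mxE; ring. Qed.

Lemma enorm_convex s u v c (r1 r2 : R) : 0 <= s <= 1 ->
  enorm (u - c) <= r1 -> enorm (v - c) <= r2 ->
  enorm (s *: u + (1 - s) *: v - c) <= s * r1 + (1 - s) * r2.
Proof.
move=> /andP[s0 s1] ur vr; rewrite convex_combB.
apply: le_trans (enormD _ _) _; rewrite !enormZ !ger0_norm ?subr_ge0 //.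
by rewrite lerD // ler_wpM2l // subr_ge0.
Qed.

Lemma sqr_enorm_convex s u v c : 0 <= s <= 1 ->
  enorm (s *: u + (1 - s) *: v - c) ^+ 2 <=
  s * enorm (u - c) ^+ 2 + (1 - s) * enorm (v - c) ^+ 2.
Proof.
move=> /andP[s0 s1]; rewrite convex_combB !sqr_enorm.
move: (u - c) (v - c) => p q.
have : 0 <= s * (1 - s) * dotv (p - q) (p - q).
  by rewrite !mulr_ge0 ?dotv_ge0 ?subr_ge0.
rewrite !dotvE (dotvC q p); move: (dotv p p) (dotv q q) (dotv p q) => a b d H.
by lra.
Qed.

Lemma sqr_enormD u v :
  enorm (u + v) ^+ 2 = enorm u ^+ 2 + 2 * dotv u v + enorm v ^+ 2.
Proof. by rewrite !sqr_enorm !dotvE (dotvC v u); ring. Qed.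

End Euclidean.
(** * Convex minimization on a convex domain *)

(** First-order conditions come from letting a step length [s] tend to 0; only
    the two leading terms in [s] ever matter. *)
Lemma ge0_of_small_slope (R : realType) (a b : R) :
  (forall e, 0 < e -> exists2 s, 0 < s <= e & 0 <= a + s * b) -> 0 <= a.
Proof.
move=> H; rewrite leNgt; apply/negP => a0.
have b1 : 0 < `|b| + 1 by rewrite ltr_wpDl.
have e0 : 0 < - a / (`|b| + 1) by rewrite divr_gt0 // oppr_gt0.
have [s /andP[s0]] := H _ e0.
rewrite ler_pdivlMr // => se; apply/negP; rewrite -ltNge.
have : s * b <= s * `|b| by rewrite ler_pM2l // ler_norm.
by nra.
Qed.

Section ConvexMinimization.
Variables (R : realType) (n : nat) (D : set 'rV[R]_n).
Implicit Types (u v w x y z c : 'rV[R]_n) (p q : 'rV[R]_n -> R).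

Definition convex_on p : Prop :=
  forall u v (s : R), D u -> D v -> 0 <= s <= 1 ->
  D (s *: u + (1 - s) *: v) /\
  p (s *: u + (1 - s) *: v) <= s * p u + (1 - s) * p v.

Lemma convex_on_addl g p : convex_on p -> convex_on (fun u => dotv g u + p u).
Proof.
move=> cp u v s Du Dv s01; have [Duv puv] := cp _ _ _ Du Dv s01.
by split=> //; rewrite !dotvE; lra.
Qed.

(** The quadratic term makes the objective strongly convex, so its minimizer [z]
    beats every competitor [u] by [c * |u - z|^2]. Moving from [z] towards [u]
    by a step [s] cannot decrease the objective; dividing by [s] and letting
    [s] tend to 0 gives a first-order inequality, which is the claim once the
    square is expanded around [z]. *)
Lemma prox_three_point q (c : R) w z : convex_on q -> D z ->
  (forall u, D u ->
     q z + c * enorm (z - w) ^+ 2 <= q u + c * enorm (u - w) ^+ 2) ->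
  forall u, D u ->
    q z + c * enorm (z - w) ^+ 2 + c * enorm (u - z) ^+ 2
      <= q u + c * enorm (u - w) ^+ 2.
Proof.
move=> cq Dz minz u Du.
suff H : 0 <= q u - q z + 2 * c * dotv (z - w) (u - z).
  have -> : u - w = (z - w) + (u - z) by rewrite [RHS]addrC addrA subrK.
  by rewrite (sqr_enormD (z - w)); lra.
apply: (@ge0_of_small_slope _ _ (c * enorm (u - z) ^+ 2)) => e e0.
exists (Num.min 1 e); first by rewrite ge_min lexx orbT lt_min ltr01 e0.
set s := Num.min 1 e.
have s0 : 0 < s by rewrite lt_min ltr01 e0.
have s1 : s <= 1 by rewrite ge_min lexx.
have [Dv qv] : _ /\ _ := cq u z s Du Dz (introT andP (conj (ltW s0) s1)).
have := minz _ Dv.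
have -> : s *: u + (1 - s) *: z - w = (z - w) + s *: (u - z).
  by apply/rowP => i; rewrite !mxE; ring.
rewrite (sqr_enormD (z - w)) enormZ exprMn (gtr0_norm s0) dotvZr.
move: (dotv _ _) (enorm (u - z) ^+ 2) (enorm (z - w) ^+ 2) => d nu nw H.
rewrite -(pmulr_rge0 _ s0).
have -> : s * (q u - q z + 2 * c * d + s * (c * nu)) =
  s * q u + (1 - s) * q z - q z + c * (2 * (s * d) + s ^+ 2 * nu) by ring.
by lra.
Qed.

Variables (f : 'rV[R]_n -> R) (g : 'rV[R]_n -> 'rV[R]_n).
Hypothesis subgrad : forall u v, D u -> D v -> f u + dotv (g u) (v - u) <= f v.

(** Subgradient inequalities alone give the quadratic upper bound. With the
    inequality at the far end [v] one gets the constant [L]; splitting the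
    segment at its midpoint turns a constant [C] into [(C + L / 2) / 2], and
    iterating this contraction leads to its fixed point [L / 2]. *)
Lemma descent_lemma (B : set 'rV[R]_n) (L : R) :
  (forall u, B u -> D u) ->
  (forall u v (s : R), B u -> B v -> 0 <= s <= 1 -> B (s *: u + (1 - s) *: v)) ->
  (forall u v, B u -> B v -> enorm (g u - g v) <= L * enorm (u - v)) ->
  forall u v, B u -> B v ->
    f v <= f u + dotv (g u) (v - u) + L / 2 * enorm (v - u) ^+ 2.
Proof.
move=> BD Bc lip u v Bu Bv.
have lipdot x y : B x -> B y ->
    dotv (g y - g x) (y - x) <= L * enorm (y - x) ^+ 2.
  move=> Bx By; apply: le_trans (cauchy_schwarz _ _) _.
  by rewrite expr2 mulrA ler_wpM2r ?enorm_ge0 ?lip.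
have halving k : forall x y, B x -> B y ->
    f y <= f x + dotv (g x) (y - x)
           + L / 2 * (1 + 2^-1 ^+ k) * enorm (y - x) ^+ 2.
  elim: k => [|k IHk] x y Bx By.
    have := subgrad (BD _ By) (BD _ Bx).
    have := lipdot x y Bx By; rewrite -(opprB y x) !dotvE expr0.
    by lra.
  set m := 2^-1 *: x + (1 - 2^-1) *: y.
  have Bm : B m by apply: Bc => //; lra.
  have := IHk _ _ Bx Bm; have := IHk _ _ Bm By; have := lipdot _ _ Bx Bm.
  have -> : y - m = 2^-1 *: (y - x) by apply/rowP => i; rewrite !mxE; field.
  have -> : m - x = 2^-1 *: (y - x) by apply/rowP => i; rewrite !mxE; field.
  rewrite enormZ exprMn !dotvZr dotvDl dotvNl ger0_norm ?invr_ge0 // (exprS _ k).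
  move: (2^-1 ^+ k) (dotv (g m) _) (dotv (g x) _) (enorm _ ^+ 2) => h dm dx e.
  by lra.
rewrite -subr_ge0.
apply: (@ge0_of_small_slope _ _ (L / 2 * enorm (v - u) ^+ 2)) => e e0.
have [k ke] : exists k, 2^-1 ^+ k <= e.
  exists (Num.truncn e^-1).+1.
  rewrite exprVn -[leRHS]invrK lef_pV2 ?posrE ?exprn_gt0 ?invr_gt0 //.
  have /ltW/le_trans -> // := truncnS_gt e^-1.
  by rewrite -natrX ler_nat ltnW // ltn_expl.
exists (2^-1 ^+ k); first by rewrite ke exprn_gt0 // invr_gt0.
by have := halving k u v Bu Bv; lra.
Qed.

(** Fermat's rule: [- g xs] is a subgradient of [p] at a minimizer [xs] of
    [f + p]. Let [v] move from [xs] towards [u]. The subgradient inequality at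
    [v] bounds [f v - f xs] from above, and minimality from below; [g v] tends
    to [g xs] by the local Lipschitz bound. *)
Lemma minimizer_subgradient p xs (L : R) (U : set 'rV[R]_n) :
  convex_on p -> D xs -> (forall u, D u -> f xs + p xs <= f u + p u) ->
  nbhs xs U ->
  (forall u v, U u -> U v -> enorm (g u - g v) <= L * enorm (u - v)) ->
  forall u, D u -> p xs <= p u + dotv (g xs) (u - xs).
Proof.
move=> cp Ds mins nU lip u Du; rewrite -subr_ge0.
apply: (@ge0_of_small_slope _ _ (L * enorm (u - xs) ^+ 2)) => e e0.
have [s /andP[s0 se] [s1 Uv]] :
    exists2 s, 0 < s <= e & s <= 1 /\ U (s *: u + (1 - s) *: xs).
  have cont : (fun s : R => s *: u + (1 - s) *: xs) @ (0 : R) --> xs.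
    rewrite -[X in _ --> X](_ : 0 *: u + (1 - 0) *: xs = xs); last first.
      by rewrite scale0r add0r subr0 scale1r.
    apply: cvgD; first by apply: cvgZr_tmp; exact: cvg_id.
    by apply: cvgZr_tmp; apply: cvgB; [exact: cvg_cst|exact: cvg_id].
  have /nbhs_ballP[r /= r0 rU] := cont _ nU.
  exists (Num.min (Num.min 1 e) (r / 2)).
    by rewrite !lt_min !ge_min ltr01 e0 divr_gt0 // lexx orbT.
  split; first by rewrite !ge_min lexx.
  apply: rU; rewrite /ball /= sub0r normrN ger0_norm.
    rewrite (le_lt_trans (_ : _ <= r / 2)) ?ge_min ?lexx ?orbT //.
    by rewrite ltr_pdivrMr // ltr_pMr // ltr1n.
  by rewrite !le_min ler01 ltW // divr_ge0 // ltW.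
exists s; first by rewrite s0.
set v := _ + _ in Uv.
have [Dv pv] : _ /\ _ := cp u xs s Du Ds (introT andP (conj (ltW s0) s1)).
have H1 := mins _ Dv; have H2 := subgrad Dv Ds.
have := lip _ _ Uv (nbhs_singleton nU).
have vE : v - xs = s *: (u - xs) by apply/rowP => i; rewrite !mxE; ring.
rewrite vE enormZ (gtr0_norm s0) => H3.
have H4 : dotv (g v - g xs) (u - xs) <= s * (L * enorm (u - xs) ^+ 2).
  apply: le_trans (cauchy_schwarz _ _) _.
  apply: le_trans (ler_wpM2r (enorm_ge0 _) H3) _.
  by lra.
move: H2 H4; rewrite -(opprB v) vE !dotvE.
rewrite -/v in pv H1 *; move: (L * _) => K; nra.
Qed.

(** If [- gs] is a subgradient of [p] at [xs], then [xs] is the proximal point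
    of [xs - gs / (2 c)], whereas [z] is that of [w - gy / (2 c)]; the bound is
    the nonexpansiveness of the proximal operator. *)
Lemma prox_distance p (c : R) w z xs gy gs :
  convex_on p -> 0 < c -> D z -> D xs ->
  (forall u, D u -> dotv gy z + p z + c * enorm (z - w) ^+ 2 <=
                    dotv gy u + p u + c * enorm (u - w) ^+ 2) ->
  (forall u, D u -> p xs <= p u + dotv gs (u - xs)) ->
  enorm (z - xs) <= enorm (w - xs) + (2 * c)^-1 * enorm (gy - gs).
Proof.
move=> cp c0 Dz Ds minz opts.
have := prox_three_point (convex_on_addl gy cp) Dz minz Ds.
have := opts _ Dz; rewrite (enorm_distC xs w) (enorm_distC xs z).
have -> : z - w = (z - xs) - (w - xs) by rewrite opprB addrA subrK.
have H1 := cauchy_schwarz (w - xs) (z - xs).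
have := cauchy_schwarz (- (gy - gs)) (z - xs); rewrite enormN.
rewrite (sqr_enormD (z - xs)) enormN dotvNr (dotvC (z - xs) (w - xs)).
set d := dotv (w - xs) _ in H1 *.
rewrite dotvNl (dotvDl gy) (dotvNl gs) !(dotvDr _ z) !(dotvNr _ xs).
set e := enorm (z - xs) in H1 *.
set h := enorm (w - xs) in H1 *; set k := enorm (gy - gs).
move=> H2 H3 /= H4.
have H5 : e * (2 * c * e) <= e * (2 * c * h + k).
  have H1' : c * d <= c * (h * e) by rewrite ler_pM2l.
  by lra.
have [e0|e0] := leP e 0.
  apply: (le_trans e0); rewrite addr_ge0 ?mulr_ge0 ?invr_ge0 ?enorm_ge0 //.
  by rewrite mulr_ge0 // ltW.
rewrite ler_pM2l // in H5.
have c2 : 0 < 2 * c by rewrite mulr_gt0.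
rewrite -(ler_pM2l c2) mulrDr mulrA mulfV ?mul1r // gt_eqF //.
Qed.

End ConvexMinimization.
(** * One iteration of the accelerated method *)

Section Scalars.
Variable R : realType.

(** Dividing the equation for [alpha] by [gammap * gamma] shows that the weight
    [alpha ^+ 2 / gamma] is updated as a convex combination of its old value
    and [mu]. *)
Lemma weight_update (mu gammap alphap gamma alpha : R) :
  0 < gammap -> 0 < gamma ->
  gammap * alpha ^+ 2 =
    (1 - alpha) * alphap ^+ 2 * gamma + mu * alpha * gamma * gammap ->
  alpha ^+ 2 / gamma = (1 - alpha) * (alphap ^+ 2 / gammap) + mu * alpha.
Proof.
move=> gp0 g0 eqa.
have -> : alpha ^+ 2 = gammap * alpha ^+ 2 / gammap.
  by rewrite mulrAC mulfV ?mul1r // gt_eqF.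
by rewrite eqa; field; rewrite !gt_eqF.
Qed.

Lemma weight_ge_mu (mu gammap alphap gamma alpha : R) :
  0 < gammap -> 0 < gamma -> alpha <= 1 ->
  mu * gammap <= alphap ^+ 2 ->
  gammap * alpha ^+ 2 =
    (1 - alpha) * alphap ^+ 2 * gamma + mu * alpha * gamma * gammap ->
  mu * gamma <= alpha ^+ 2.
Proof.
move=> gp0 g0 a1 mup eqa; rewrite -(ler_pM2l gp0) eqa.
have : (1 - alpha) * gamma * (mu * gammap) <= (1 - alpha) * gamma * alphap ^+ 2.
  by rewrite ler_wpM2l // mulr_ge0 ?subr_ge0 // ltW.
by lra.
Qed.

Lemma beta_bounds (mu gamma alpha : R) :
  0 <= mu -> 0 < gamma -> 0 < alpha -> mu * gamma <= alpha ^+ 2 ->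
  0 <= mu * gamma * alpha^-1 <= alpha.
Proof.
move=> mu0 g0 a0 mua; rewrite ler_pdivrMr // -expr2 mua andbT.
by rewrite !mulr_ge0 ?invr_ge0 // ltW.
Qed.

End Scalars.

Section Extrapolation.
Variables (R : realType) (n : nat).
Implicit Types x y z : 'rV[R]_n.

Lemma extrapolation_spec (alpha beta : R) x z y :
  0 < alpha <= 1 -> 0 <= beta <= alpha -> extrapolation alpha beta x z y ->
  (exists2 s : R, 0 <= s <= 1 & y = s *: x + (1 - s) *: z) /\
  (1 - alpha * beta) *: y = (1 - alpha) *: x + (alpha * (1 - beta)) *: z.
Proof.
move=> /andP[a0 a1] /andP[b0 ba]; rewrite /extrapolation.
have ab1 : alpha * beta <= alpha by rewrite ler_piMr // ?(le_trans ba) // ltW.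
case: ifPn => [/eqP ab0 [s /andP[s0 s1] ->]|ab0 ->].
  (* Here [alpha = beta = 1]: [z] has coefficient 0 in the equation for [y]. *)
  split.
    exists (1 - s); first by lra.
    by rewrite opprB addrCA subrr addr0.
  have alpha1 : alpha = 1 by lra.
  have beta1 : beta = 1 by move: ab0; rewrite alpha1; lra.
  by rewrite alpha1 beta1 mulr1 subrr mulr0 !scale0r addr0.
have d0 : 0 < 1 - alpha * beta by rewrite lt_def ab0 /=; lra.
have ne := lt0r_neq0 d0.
split; last by rewrite scalerA mulfV // scale1r.
exists ((1 - alpha * beta)^-1 * (1 - alpha)).
  rewrite [_^-1 * _]mulrC ler_pdivrMr // mul1r lerB // andbT.
  by rewrite divr_ge0 ?subr_ge0 // ltW // -subr_gt0.
rewrite scalerDr !scalerA; congr (_ + _ *: _).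
by field; rewrite ne.
Qed.

End Extrapolation.

Section AcceleratedStep.
Variables (R : realType) (n : nat) (D : set 'rV[R]_n).
Variables (f p : 'rV[R]_n -> R) (g : 'rV[R]_n -> 'rV[R]_n) (mu : R).
Hypothesis p_convex : convex_on D p.
Hypothesis mu_ge0 : 0 <= mu.
Hypothesis strong_subgrad : forall u v, D u -> D v ->
  f u + dotv (g u) (v - u) + mu / 2 * enorm (u - v) ^+ 2 <= f v.

Lemma weak_subgrad u v : D u -> D v -> f u + dotv (g u) (v - u) <= f v.
Proof.
move=> Du Dv; apply: le_trans (strong_subgrad Du Dv).
by rewrite lerDl mulr_ge0 ?sqr_ge0 // divr_ge0.
Qed.

Variables (gamma alpha beta : R) (x y z z1 xs : 'rV[R]_n).
Hypotheses (gamma_gt0 : 0 < gamma) (alpha01 : 0 < alpha <= 1).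
Hypothesis betaE : beta = mu * gamma * alpha^-1.
Hypothesis beta_le : 0 <= beta <= alpha.
Hypotheses (Dx : D x) (Dy : D y) (Dz1 : D z1) (Dxs : D xs).

Local Notation w := (beta *: y + (1 - beta) *: z).
Local Notation x1 := ((1 - alpha) *: x + alpha *: z1).

Hypothesis z1_min : forall u, D u ->
  dotv (g y) z1 + p z1 + alpha / 2 / gamma * enorm (z1 - w) ^+ 2 <=
  dotv (g y) u + p u + alpha / 2 / gamma * enorm (u - w) ^+ 2.

(** The decrease of the potential. The point [y] is chosen so that
    [x1 - y = alpha *: (z1 - w)], whence the quadratic term of the acceptance
    test is [alpha] times the one in the proximal objective. The model of [F]
    at [y] is then split by convexity into its values at [x] and at [z1]; the
    three-point inequality moves the latter to [xs], and the strong convexity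
    of [f] cancels the [y]-part of [w] because
    [alpha ^+ 2 / gamma * beta = alpha * mu]. *)
Lemma potential_step (Ap : R) :
  (1 - alpha * beta) *: y = (1 - alpha) *: x + (alpha * (1 - beta)) *: z ->
  alpha ^+ 2 / gamma = (1 - alpha) * Ap + mu * alpha ->
  2 * gamma * (f x1 - f y - dotv (g y) (x1 - y)) <= enorm (x1 - y) ^+ 2 ->
  f x1 + p x1 - (f xs + p xs) + alpha ^+ 2 / gamma / 2 * enorm (z1 - xs) ^+ 2
  <= (1 - alpha) * (f x + p x - (f xs + p xs) + Ap / 2 * enorm (z - xs) ^+ 2).
Proof.
move=> yE AE; have /andP[a0 a1] := alpha01; have /andP[b0 ba] := beta_le.
have a1' : 0 <= 1 - alpha by rewrite subr_ge0.
have x1y : x1 - y = alpha *: (z1 - w).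
  apply/rowP => i; have /rowP/(_ i) := yE; rewrite !mxE => H.
  by lra.
have x1yD : dotv (g y) (x1 - y) =
    (1 - alpha) * dotv (g y) (x - y) + alpha * dotv (g y) (z1 - y).
  by rewrite !dotvE; ring.
rewrite x1yD x1y enormZ exprMn (gtr0_norm a0).
pose c := alpha / 2 / gamma.
have gc : 2 * gamma * c = alpha by rewrite /c; field; rewrite gt_eqF.
set q := enorm (z1 - w) ^+ 2.
have -> : alpha ^+ 2 * q = 2 * gamma * (alpha * c * q)
  by transitivity (2 * gamma * c * (alpha * q)); [rewrite gc|]; ring.
rewrite ler_pM2l ?mulr_gt0 // => Hacc.
have [_ Hp] : D x1 /\ p x1 <= (1 - alpha) * p x + alpha * p z1.
  by have := @p_convex x z1 (1 - alpha) Dx Dz1; rewrite subKr; apply; lra.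
have Hx : (1 - alpha) * (f y + dotv (g y) (x - y)) <= (1 - alpha) * f x.
  by rewrite ler_wpM2l // weak_subgrad.
have Hs : alpha * (f y + dotv (g y) (xs - y) + mu / 2 * enorm (y - xs) ^+ 2)
    <= alpha * f xs.
  by rewrite ler_pM2l // strong_subgrad.
have Hz : _ + c * _ + c * _ <= _ + c * _ :=
  prox_three_point (convex_on_addl (g y) p_convex) Dz1 z1_min Dxs.
rewrite -(ler_pM2l a0) (enorm_distC xs w) (enorm_distC xs z1) -/q in Hz.
have cb : c * beta = mu / 2 by rewrite /c betaE; field; rewrite !gt_eqF.
have ac : alpha ^+ 2 / gamma = 2 * (alpha * c).
  by rewrite /c; field; rewrite gt_eqF.
have b01 : 0 <= beta <= 1 by rewrite b0 (le_trans ba).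
have Hw := sqr_enorm_convex y z xs b01.
have ac0 : 0 <= alpha * c by rewrite !mulr_ge0 ?invr_ge0 ?ltW.
have := ler_wpM2l ac0 Hw.
have -> : alpha * c *
    (beta * enorm (y - xs) ^+ 2 + (1 - beta) * enorm (z - xs) ^+ 2) =
  alpha * (c * beta) * enorm (y - xs) ^+ 2
    + (alpha ^+ 2 / gamma / 2 - alpha * (c * beta)) * enorm (z - xs) ^+ 2.
  by rewrite ac; field.
rewrite cb AE => {}Hw; rewrite -AE ac.
move: Hz Hs Hx Hacc; rewrite !(dotvDr _ _ (- y)).
by lra.
Qed.

(** Both [z1] and [xs] are proximal points, so nonexpansiveness bounds
    [z1 - xs]. The factor [gamma / alpha] in that bound is harmless, since
    [z1] enters [x1] with the weight [alpha]. *)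
Lemma trial_radius (L rho : R) :
  (forall u, D u -> p xs <= p u + dotv (g xs) (u - xs)) ->
  enorm (g y - g xs) <= L * rho ->
  enorm (x - xs) <= rho -> enorm (y - xs) <= rho -> enorm (z - xs) <= rho ->
  enorm (x1 - xs) <= (1 + gamma * L) * rho.
Proof.
move=> opts Hg xr yr zr; have /andP[a0 a1] := alpha01.
have /andP[b0 ba] := beta_le.
have b01 : 0 <= beta <= 1 by rewrite b0 (le_trans ba).
have c0 : 0 < alpha / 2 / gamma by rewrite !divr_gt0.
have := prox_distance p_convex c0 Dz1 Dxs z1_min opts.
have -> : (2 * (alpha / 2 / gamma))^-1 = gamma / alpha.
  by field; rewrite !gt_eqF.
move=> H; have wr : enorm (w - xs) <= rho.
  by apply: le_trans (enorm_convex b01 yr zr) _; lra.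
have z1r : enorm (z1 - xs) <= rho + gamma / alpha * (L * rho).
  by apply: le_trans H _; rewrite lerD // ler_wpM2l // ltW // divr_gt0.
have a01' : 0 <= 1 - alpha <= 1 by lra.
have := enorm_convex a01' xr z1r; rewrite subKr => /le_trans; apply.
have -> : alpha * (rho + gamma / alpha * (L * rho)) =
    alpha * rho + gamma * (L * rho) by field; rewrite gt_eqF.
by lra.
Qed.

End AcceleratedStep.

(** * Convergence rates *)

Section Rates.
Variable R : realType.

(** With [q] and [s] the square roots of two successive contraction factors,
    the claim is [1 / s >= 1 / q + c / 2], without divisions because the
    factor vanishes when [a = 1]. It comes from
    [2 * q * (q - s) >= q ^+ 2 - s ^+ 2 = a * q ^+ 2]. *)
Lemma accelerated_step (q s a c K : R) :
  0 <= q -> 0 <= s -> 0 <= a -> 0 <= c ->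
  s ^+ 2 = (1 - a) * q ^+ 2 -> c * s <= a -> q * K <= 2 -> s * (K + c) <= 2.
Proof.
move=> q0 s0 a0 c0 sE csa qK.
have sq : s <= q.
  rewrite -(@ler_pXn2r _ 2) ?nnegrE // sE mulrBl mul1r gerBl.
  by rewrite mulr_ge0 // sqr_ge0.
have [q0'|q0'] := eqVneq q 0.
  have -> : s = 0 by apply: le_anti; rewrite s0 -q0' sq.
  by rewrite mul0r.
have qp : 0 < q by rewrite lt_def q0' q0.
have H1 : c * s * q ^+ 2 <= a * q ^+ 2 by rewrite ler_wpM2r // sqr_ge0.
have H2 : 0 <= (q - s) * (q - s) by rewrite -expr2 sqr_ge0.
have H3 : q * (c * s * q) <= q * (2 * (q - s)).
  have H4 : a * q ^+ 2 = q ^+ 2 - s ^+ 2 by rewrite sE; ring.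
  by lra.
rewrite ler_pM2l // in H3.
have H4 : s * (q * K) <= s * 2 by rewrite ler_wpM2l.
by rewrite -(ler_pM2l qp); lra.
Qed.

(** Each factor [1 - a t] shrinks [Q], but [a t] is only bounded below in terms
    of the square root of [Q t]; this makes [1 / Num.sqrt (Q t)] grow linearly
    in [t]. *)
Lemma accelerated_rate (a Q : nat -> R) (c : R) :
  0 <= c -> Q 0%N = 1 -> (forall t, 0 <= Q t) ->
  (forall t, Q t.+1 = (1 - a t.+1) * Q t) -> (forall t, 0 <= a t.+1) ->
  (forall t, c ^+ 2 * Q t.+1 <= a t.+1 ^+ 2) ->
  forall t, Q t <= 4 * (2 + t%:R * c) ^- 2.
Proof.
move=> c0 Q0 Qge0 QS a0 ac t.
have key : Num.sqrt (Q t) * (2 + t%:R * c) <= 2.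
  elim: t => [|t IHt]; first by rewrite Q0 sqrtr1 mul0r addr0 mul1r.
  rewrite -[t.+1%:R]natr1 mulrDl mul1r addrA.
  apply: (@accelerated_step (Num.sqrt (Q t)) _ (a t.+1)) => //;
    rewrite ?sqrtr_ge0 ?sqr_sqrtr //.
  rewrite -(@ler_pXn2r _ 2) ?nnegrE ?mulr_ge0 ?sqrtr_ge0 //.
  by rewrite exprMn sqr_sqrtr.
have pos : 0 < 2 + t%:R * c by rewrite ltr_wpDr // mulr_ge0.
rewrite ler_pdivlMr ?exprn_gt0 // -[Q t]sqr_sqrtr // -exprMn.
have -> : 4 = 2 ^+ 2 :> R by ring.
by rewrite ler_pXn2r ?nnegrE ?mulr_ge0 ?sqrtr_ge0 // ltW.
Qed.

Lemma geometric_rate (a Q : nat -> R) (c : R) :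
  Q 0%N = 1 -> (forall t, 0 <= Q t) ->
  (forall t, Q t.+1 = (1 - a t.+1) * Q t) ->
  (forall t, c <= a t.+1 <= 1) ->
  forall t, Q t <= (1 - c) ^+ t.
Proof.
move=> Q0 Qge0 QS ac; elim=> [|t IHt]; first by rewrite Q0 expr0.
have /andP[ca a1] := ac t.
by rewrite QS exprS ler_pM // ?subr_ge0 // lerB.
Qed.

End Rates.
(** * From extended-valued functions to real functions on the domain of [P] *)

Section Domain.
Variables (R : realType) (n : nat) (f P : 'rV[R]_n -> \bar R) (mu : R).
Implicit Types (u v x y z xs : 'rV[R]_n).

Local Notation D := (edom P).
Local Notation fr := (fine \o f).
Local Notation Pr := (fine \o P).

Hypothesis P_pcc : proper_closed_convex P.
Hypothesis f_diff : forall u, closure D u -> ediff f u.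

Lemma edom_fineP u : D u -> P u = (Pr u)%:E.
Proof.
have [[Pgt _] _ _] := P_pcc.
by move=> Du; rewrite /= fineK // fin_real // Pgt.
Qed.

Lemma edom_finef u : D u -> f u = (fr u)%:E.
Proof.
move=> Du; rewrite /= fineK //.
by have [/nbhs_singleton] := f_diff (subset_closure Du).
Qed.

Lemma edom_convex_on : convex_on D Pr.
Proof.
have [_ _ Pc] := P_pcc; move=> u v s Du Dv s01.
have := Pc u v s s01.
rewrite (edom_fineP Du) (edom_fineP Dv) -!EFinM -EFinD => H.
have Duv : D (s *: u + (1 - s) *: v) by apply: le_lt_trans H _; rewrite ltry.
by split=> //; move: H; rewrite (edom_fineP Duv) lee_fin.
Qed.

Lemma edom_strong_subgrad : convexity_parameter f mu D ->
  forall u v, D u -> D v ->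
  fr u + dotv (grad f u) (v - u) + mu / 2 * enorm (u - v) ^+ 2 <= fr v.
Proof.
move=> fmu u v Du Dv; have := fmu u v Du.
by rewrite (edom_finef Du) (edom_finef Dv) -EFinD lee_fin addrA.
Qed.

Lemma edom_argmin xs : D xs -> is_argmin (fun u => f u + P u)%E xs ->
  forall u, D u -> fr xs + Pr xs <= fr u + Pr u.
Proof.
move=> Dxs mins u Du; have := mins u.
rewrite (edom_finef Dxs) (edom_fineP Dxs) (edom_finef Du) (edom_fineP Du).
by rewrite -!EFinD lee_fin.
Qed.

Lemma edom_accepts (gamma : R) y x1 : D y -> D x1 ->
  accepts f gamma y x1 <->
  2 * gamma * (fr x1 - fr y - dotv (grad f y) (x1 - y)) <= enorm (x1 - y) ^+ 2.
Proof.
move=> Dy Dx1; rewrite /accepts (edom_finef Dy) (edom_finef Dx1).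
by rewrite -!EFinB -EFinM lee_fin.
Qed.

Lemma edom_prox (gamma alpha beta : R) x y z z1 : 0 < gamma -> D x ->
  is_argmin (prox_objective f P gamma alpha beta y z) z1 ->
  D z1 /\ forall u, D u ->
    dotv (grad f y) z1 + Pr z1
      + alpha / 2 / gamma * enorm (z1 - (beta *: y + (1 - beta) *: z)) ^+ 2 <=
    dotv (grad f y) u + Pr u
      + alpha / 2 / gamma * enorm (u - (beta *: y + (1 - beta) *: z)) ^+ 2.
Proof.
move=> g0 Dx minz.
have Dz1 : D z1.
  have := minz x; rewrite /prox_objective (edom_fineP Dx) -EFinD.
  rewrite /edom /= ltey; apply: contraTneq => ->.
  by rewrite addey // gt0_muley ?lte_fin // addye // -ltNge ltry.
split=> // u Du; have := minz u; rewrite /prox_objective.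
rewrite (edom_fineP Du) (edom_fineP Dz1) -!EFinD lee_fin.
have E v : v - beta *: y - (1 - beta) *: z = v - (beta *: y + (1 - beta) *: z).
  by rewrite opprD addrA.
have K (q : R) : gamma * (alpha / 2 / gamma * q) = alpha / 2 * q.
  by field; rewrite gt_eqF.
by rewrite !E => H; rewrite -(ler_pM2l g0) 2!(mulrDr gamma (_ + _)) !K.
Qed.

End Domain.

Lemma dom_ball_convex (R : realType) (n : nat) (P : 'rV[R]_n -> \bar R) p
    (c : 'rV[R]_n) (r s : R) u v :
  convex_on (edom P) p -> dom_ball P c r u -> dom_ball P c r v -> 0 <= s <= 1 ->
  dom_ball P c r (s *: u + (1 - s) *: v).
Proof.
move=> cp [Du ur] [Dv vr] s01; split; first by have [] := cp _ _ _ Du Dv s01.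
by apply: le_trans (enorm_convex s01 ur vr) _; lra.
Qed.

(** * Step sizes and potential along the iteration *)

Section Iteration.
Variables (R : realType) (n : nat) (f P : 'rV[R]_n -> \bar R).
Variables (mu gamma0 alpha0 delta rho LS LShat : R) (xs : 'rV[R]_n).

Local Notation D := (edom P).
Local Notation fr := (fine \o f).
Local Notation Pr := (fine \o P).

Hypothesis P_pcc : proper_closed_convex P.
Hypothesis f_diff : forall u, closure D u -> ediff f u.
Hypothesis f_lip : locally_lipschitz_grad f (closure D).
Hypothesis Dxs : D xs.
Hypothesis xs_min : is_argmin (fun u => f u + P u)%E xs.
Hypothesis mu_ge0 : 0 <= mu.
Hypothesis f_mu : convexity_parameter f mu D.
Hypotheses (gamma0_gt0 : 0 < gamma0) (delta01 : 0 < delta < 1).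
Hypothesis rho_ge0 : 0 <= rho.
Hypotheses (LS_gt0 : 0 < LS) (lipS : lipschitz_grad f LS (dom_ball P xs rho)).
Hypothesis LShat_gt0 : 0 < LShat.
Hypothesis lipShat :
  lipschitz_grad f LShat (dom_ball P xs ((1 + gamma0 * LS) * rho)).

Let P_convex : convex_on D Pr := edom_convex_on P_pcc.
Let f_strong := edom_strong_subgrad f_diff f_mu.
Let f_subgrad := weak_subgrad mu_ge0 f_strong.

Lemma minimizer_optimality u : D u -> Pr xs <= Pr u + dotv (grad f xs) (u - xs).
Proof.
have [L [U [_ Uo Uxs _ lipU]]] := f_lip (subset_closure Dxs).
have mins := edom_argmin P_pcc f_diff Dxs xs_min.
have nU := open_nbhs_nbhs (conj Uo Uxs).
have H := minimizer_subgradient f_subgrad P_convex Dxs mins nU lipU.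
exact: H.
Qed.

(** The facts about the state of the algorithm that its step-size search relies
    on; they hold before every iteration. *)
Record admissible (gammap alphap : R) (x z : 'rV[R]_n) : Prop := Admissible {
  adm_gamma : 0 < gammap;
  adm_mu : mu * gammap <= alphap ^+ 2;
  adm_x : dom_ball P xs rho x;
  adm_z : dom_ball P xs rho z
}.

Definition gap u := fr u + Pr u - (fr xs + Pr xs).

Lemma gap_ge0 u : D u -> 0 <= gap u.
Proof. by move=> Du; rewrite subr_ge0; exact: edom_argmin. Qed.

Section Trial.
Variables (gammap alphap : R) (x z : 'rV[R]_n) (m : nat).
Variables (gamma alpha beta : R) (y z1 x1 : 'rV[R]_n).
Hypothesis adm : admissible gammap alphap x z.
Hypothesis tr :
  trial f P mu gamma0 delta gammap alphap x z m gamma alpha beta y z1 x1.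

Lemma trial_gamma_gt0 : 0 < gamma.
Proof.
have [-> _ _ _ _ _ _] := tr; have /andP[d0 _] := delta01.
by rewrite mulr_gt0 // exprn_gt0.
Qed.

Lemma trial_gamma_le : gamma <= gamma0.
Proof.
have [-> _ _ _ _ _ _] := tr; have /andP[d0 d1] := delta01.
by rewrite ler_piMr ?exprn_ile1 // ltW.
Qed.

Lemma trial_mu : mu * gamma <= alpha ^+ 2.
Proof.
have [gp0 mup _ _] := adm; have [_ /andP[_ a1] eqa _ _ _ _] := tr.
exact: weight_ge_mu gp0 trial_gamma_gt0 a1 mup eqa.
Qed.

Lemma trial_weight :
  alpha ^+ 2 / gamma = (1 - alpha) * (alphap ^+ 2 / gammap) + mu * alpha.
Proof.
have [gp0 _ _ _] := adm; have [_ _ eqa _ _ _ _] := tr.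
exact: weight_update gp0 trial_gamma_gt0 eqa.
Qed.

Lemma trial_beta_le : 0 <= beta <= alpha.
Proof.
have [_ /andP[a0 _] _ -> _ _ _] := tr.
exact: beta_bounds mu_ge0 trial_gamma_gt0 a0 trial_mu.
Qed.

Lemma trial_y_ball : dom_ball P xs rho y.
Proof.
have [_ _ adx adz] := adm; have [_ a01 _ _ ey _ _] := tr.
have [[s s01 ->] _] := extrapolation_spec a01 trial_beta_le ey.
exact: dom_ball_convex P_convex adx adz s01.
Qed.

Lemma trial_edom_z1 : D z1.
Proof.
have [_ _ [Dx _] _] := adm; have [_ _ _ _ _ mz _] := tr.
by have [] := edom_prox P_pcc trial_gamma_gt0 Dx mz.
Qed.

Lemma trial_edom_x1 : D x1.
Proof.
have [_ _ [Dx _] _] := adm; have [_ a01 _ _ _ _ ->] := tr.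
have a01' : 0 <= 1 - alpha <= 1 by lra.
by have := P_convex Dx trial_edom_z1 a01'; rewrite subKr => -[].
Qed.

(** The trial point stays in the larger ball for every candidate step size,
    accepted or not: [gamma] never exceeds [gamma0]. *)
Lemma trial_x1_ball : dom_ball P xs ((1 + gamma0 * LS) * rho) x1.
Proof.
split; first exact: trial_edom_x1.
have [_ _ [Dx xr] [Dz zr]] := adm; have [_ a01 _ _ _ mz ->] := tr.
have [Dz1 minz] := edom_prox P_pcc trial_gamma_gt0 Dx mz.
have [Dy yr] := trial_y_ball.
have sb : dom_ball P xs rho xs.
  by split; rewrite // subrr -(scale0r (0 : 'rV[R]_n)) enormZ normr0 mul0r.
have Hg : enorm (grad f y - grad f xs) <= LS * rho.
  apply: le_trans (lipS trial_y_ball sb) _.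
  by rewrite ler_pM2l.
apply: le_trans (trial_radius P_convex trial_gamma_gt0 a01 trial_beta_le Dz1 Dxs
  minz minimizer_optimality Hg xr yr zr) _.
by rewrite ler_wpM2r // lerD2l ler_pM2r // trial_gamma_le.
Qed.

(** The descent lemma on the larger ball accepts every step size up to
    [LShat^-1]. *)
Lemma rejected_gamma : ~ accepts f gamma y x1 -> 1 < gamma * LShat.
Proof.
have yb := trial_y_ball; have x1b := trial_x1_ball.
have [Dy yr] := yb; have [Dx1 _] := x1b.
apply: contra_notT; rewrite -leNgt => gL; apply/(edom_accepts f_diff _ Dy Dx1).
have yb' : dom_ball P xs ((1 + gamma0 * LS) * rho) y.
  split=> //; apply: le_trans yr _.
  by rewrite ler_peMl // lerDl mulr_ge0 // ltW.
have := descent_lemma f_subgrad (fun u => @proj1 _ _)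
  (fun u v s => @dom_ball_convex _ _ _ _ _ _ s u v P_convex) lipShat yb' x1b.
have g0 := trial_gamma_gt0; have := sqr_ge0 (enorm (x1 - y)).
move: (enorm _ ^+ 2) (dotv _ _) (fr x1) (fr y) => e d a b e0 H.
have H1 : gamma * (a - b - d) <= gamma * (LShat / 2 * e).
  by rewrite ler_pM2l //; lra.
have H2 : gamma * LShat * e <= 1 * e by rewrite ler_wpM2r.
by lra.
Qed.

Lemma trial_potential : accepts f gamma y x1 ->
  gap x1 + alpha ^+ 2 / gamma / 2 * enorm (z1 - xs) ^+ 2 <=
  (1 - alpha) * (gap x + alphap ^+ 2 / gammap / 2 * enorm (z - xs) ^+ 2).
Proof.
have [Dy yr] := trial_y_ball.
move/(edom_accepts f_diff _ Dy trial_edom_x1).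
have [_ _ [Dx xr] [Dz zr]] := adm; have [_ a01 _ eb ey mz x1E] := tr.
have [Dz1 minz] := edom_prox P_pcc trial_gamma_gt0 Dx mz.
have [_ yE] := extrapolation_spec a01 trial_beta_le ey.
rewrite x1E => acc.
have H := potential_step P_convex mu_ge0 f_strong trial_gamma_gt0 a01 eb
  trial_beta_le Dx Dy Dz1 Dxs minz yE trial_weight acc.
exact: H.
Qed.

End Trial.

Section Run.
Variables (nn : nat -> nat) (gamma alpha beta : nat -> R).
Variables (x y z : nat -> 'rV[R]_n) (r0 : R).
Hypotheses (alpha0_gt0 : 0 < alpha0) (mu_alpha0 : mu * gamma0 <= alpha0 ^+ 2).
Hypothesis gen :
  generated f P mu gamma0 alpha0 delta nn gamma alpha beta x y z.
Hypothesis r0E :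
  gap (x 1%N) + alpha0 ^+ 2 / gamma0 / 2 * enorm (x 1%N - xs) ^+ 2 = r0 ^+ 2.
Hypothesis rhoE : rho ^+ 2 = 2 * r0 ^+ 2 / (alpha0 ^+ 2 / gamma0).

Definition weight t := alpha t ^+ 2 / gamma t.

Definition potential t :=
  gap (x t.+1) + weight t / 2 * enorm (z t.+1 - xs) ^+ 2.

Definition contraction t := \prod_(i < t) (1 - alpha i.+1).

Lemma contractionS t : contraction t.+1 = (1 - alpha t.+1) * contraction t.
Proof. by rewrite /contraction big_ord_recr mulrC. Qed.

Lemma alpha01 t : 0 < alpha t.+1 <= 1.
Proof. by have [] := gen_step gen (ltn0Sn t). Qed.

Lemma contraction_ge0 t : 0 <= contraction t.
Proof.
by apply: prodr_ge0 => i _; rewrite subr_ge0; case/andP: (alpha01 i).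
Qed.

(** In one iteration the potential shrinks at least as much as the weight. As
    the weight multiplies the squared distance from [z t.+1] to [xs] in the
    potential, this keeps [z t.+1] in the ball, even after an [alpha i] equal
    to 1, where the contraction factor becomes 0. *)
Lemma potential_radius t : D (x t.+1) -> 0 < weight t ->
  weight 0 * potential t <= weight t * r0 ^+ 2 -> enorm (z t.+1 - xs) <= rho.
Proof.
move=> Dx w0; rewrite /potential.
rewrite /weight (gen_gamma0 gen) (gen_alpha0 gen) -/(weight t) => H.
have A0 : 0 < alpha0 ^+ 2 / gamma0 by rewrite divr_gt0 // exprn_gt0.
rewrite -(@ler_pXn2r _ 2) ?nnegrE ?enorm_ge0 // rhoE ler_pdivlMr //.
have G := mulr_ge0 (ltW A0) (gap_ge0 Dx).
by rewrite -(ler_pM2l w0); lra.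
Qed.

Lemma run_invariant t :
  [/\ admissible (gamma t) (alpha t) (x t.+1) (z t.+1), 0 < weight t,
      weight 0 * potential t <= weight t * r0 ^+ 2,
      potential t <= contraction t * r0 ^+ 2 &
      weight 0 * contraction t <= weight t].
Proof.
have w00 : 0 < weight 0.
  by rewrite /weight (gen_gamma0 gen) (gen_alpha0 gen) divr_gt0 // exprn_gt0.
elim: t => [|t [adm w0 H1 H2 H3]].
  have E0 : potential 0 = r0 ^+ 2.
    rewrite /potential /weight -(gen_init gen).
    by rewrite (gen_gamma0 gen) (gen_alpha0 gen).
  have H1 : weight 0 * potential 0 <= weight 0 * r0 ^+ 2 by rewrite E0.
  have zr := potential_radius (gen_dom gen) w00 H1.
  have zb : dom_ball P xs rho (z 1%N).
    by split; rewrite // -(gen_init gen); exact: gen_dom gen.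
  have C0 : contraction 0 = 1 by rewrite /contraction big_ord0.
  split=> //; last 2 first.
  - by rewrite C0 mul1r E0.
  - by rewrite C0 mulr1.
  - by split=> //; rewrite ?(gen_gamma0 gen) ?(gen_alpha0 gen) ?(gen_init gen).
have tr := gen_step gen (ltn0Sn t); rewrite /= in tr.
have /andP[a0 a1] := alpha01 t.
have a1' : 0 <= 1 - alpha t.+1 by rewrite subr_ge0.
have w1 : 0 < weight t.+1 by rewrite divr_gt0 ?exprn_gt0 // (trial_gamma_gt0 tr).
have wS : (1 - alpha t.+1) * weight t <= weight t.+1.
  by rewrite /weight (trial_weight adm tr) lerDl mulr_ge0 // ltW.
have pS : potential t.+1 <= (1 - alpha t.+1) * potential t.
  exact: trial_potential adm tr (gen_accept gen (ltn0Sn t)).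
have r2 := sqr_ge0 r0.
have H1' : weight 0 * potential t.+1 <= weight t.+1 * r0 ^+ 2.
  have := ler_wpM2l (ltW w00) pS; have := ler_wpM2r r2 wS.
  by have := ler_wpM2l a1' H1; lra.
have Dx1 := trial_edom_x1 adm tr; have Dz1 := trial_edom_z1 adm tr.
have zb : dom_ball P xs rho (z t.+2).
  by split=> //; exact: potential_radius Dx1 w1 H1'.
split=> //.
- split=> //; [exact: trial_gamma_gt0 tr|exact: trial_mu adm tr|].
  rewrite (trial_x tr).
  have a01' : 0 <= 1 - alpha t.+1 <= 1 by lra.
  have := dom_ball_convex P_convex (adm_x adm) zb a01'.
  by rewrite subKr.
- by apply: (le_trans pS); rewrite contractionS -mulrA ler_wpM2l.
- apply: le_trans wS; rewrite contractionS mulrCA.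
  by rewrite ler_wpM2l.
Qed.

(** Unless [gamma0] itself is accepted, the candidate just before the accepted
    one, which is larger by the factor [delta^-1], was rejected and hence
    exceeds [LShat^-1]. *)
Lemma gamma_lower_bound t : Num.min gamma0 (delta * LShat^-1) <= gamma t.+1.
Proof.
have tr := gen_step gen (ltn0Sn t); rewrite /= in tr.
have gS := trial_gamma tr; rewrite ge_min.
case E: (nn t.+1) gS => [|m] ->; first by rewrite expr0 mulr1 lexx.
have [] := @gen_smallest _ _ _ _ _ _ _ _ _ _ _ _ _ _ _ gen t.+1 m (ltn0Sn t).
  by rewrite E.
move=> g [a [b [y' [z' [x' [tr' /(rejected_gamma _ tr') rej]]]]]].
have [adm _ _ _ _] := run_invariant t.
have /andP[d0 _] := delta01.
apply/orP; right; rewrite exprS mulrCA -(trial_gamma tr') ler_pM2l //.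
by rewrite -div1r ler_pdivrMr // ltW // rej.
Qed.

Lemma gap_le_contraction t : gap (x t.+1) <= contraction t * r0 ^+ 2.
Proof.
have [_ w0 _ H _] := run_invariant t; apply: le_trans H.
by rewrite lerDl mulr_ge0 ?sqr_ge0 // divr_ge0 // ltW.
Qed.

(** Here [alpha] is at least the square root of [mu * gamma]. *)
Lemma contraction_geometric t :
  contraction t <= (1 - Num.sqrt (mu * Num.min gamma0 (delta * LShat^-1))) ^+ t.
Proof.
apply: geometric_rate contraction_ge0 contractionS _ t.
  by rewrite /contraction big_ord0.
move=> t; have /andP[a0 ->] := alpha01 t; rewrite andbT.
have [adm _ _ _ _] := run_invariant t.+1.
rewrite -[leRHS]gtr0_norm // -sqrtr_sqr ler_wsqrtr //.
apply: le_trans (adm_mu adm).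
by rewrite ler_wpM2l // gamma_lower_bound.
Qed.

(** Here [alpha ^+ 2] is [gamma] times the weight, and the weight is at least
    its initial value times the contraction factor. *)
Lemma contraction_accelerated t :
  contraction t <= 4 * (2 + t%:R * alpha0 *
     Num.sqrt (Num.min 1 (delta * gamma0^-1 * LShat^-1))) ^- 2.
Proof.
rewrite -[t%:R * _ * _]mulrA.
have /andP[d0 _] := delta01.
have k0 : 0 <= Num.min 1 (delta * gamma0^-1 * LShat^-1).
  by rewrite le_min ler01 !mulr_ge0 ?invr_ge0 // ltW.
apply: accelerated_rate contraction_ge0 contractionS _ _ t.
- by rewrite mulr_ge0 ?sqrtr_ge0 // ltW.
- by rewrite /contraction big_ord0.
- by move=> t; case/andP: (alpha01 t) => /ltW.
move=> t; have [adm _ _ _ H] := run_invariant t.+1.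
have g0 := adm_gamma adm.
rewrite /weight (gen_gamma0 gen) (gen_alpha0 gen) ler_pdivlMr // in H.
apply: le_trans H; rewrite exprMn sqr_sqrtr //.
have -> : alpha0 ^+ 2 / gamma0 * contraction t.+1 * gamma t.+1 =
    alpha0 ^+ 2 * (gamma t.+1 / gamma0) * contraction t.+1 by ring.
rewrite ler_wpM2r ?contraction_ge0 // ler_wpM2l ?sqr_ge0 //.
rewrite ler_pdivlMr // minr_pMl; last exact: ltW.
have -> : delta * gamma0^-1 * LShat^-1 * gamma0 = delta * LShat^-1.
  by field; rewrite !gt_eqF.
by rewrite mul1r gamma_lower_bound.
Qed.

Lemma gap_rate t : D (x t.+1) /\ gap (x t.+1) <=
  Num.min ((1 - Num.sqrt (mu * Num.min gamma0 (delta * LShat^-1))) ^+ t)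
    (4 * (2 + t%:R * alpha0 *
       Num.sqrt (Num.min 1 (delta * gamma0^-1 * LShat^-1))) ^- 2) * r0 ^+ 2.
Proof.
split; first by have [[_ _ [Dx _] _] _ _ _ _] := run_invariant t.
apply: (le_trans (gap_le_contraction t)); rewrite ler_wpM2r ?sqr_ge0 // le_min.
by rewrite contraction_geometric contraction_accelerated.
Qed.

End Run.
End Iteration.

(** * The convergence theorem *)

Theorem theorem2 (R : realType) (n : nat) (f P : 'rV[R]_n -> \bar R)
    (mu gamma0 alpha0 delta : R) (xs : 'rV[R]_n)
    (nn : nat -> nat) (gamma alpha beta : nat -> R) (x y z : nat -> 'rV[R]_n)
    (LS LShat : R) :
  let F := fun u : 'rV[R]_n => (f u + P u)%E in
  let r0 := Num.sqrt (fine (F (x 1%N)) - fine (F xs)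
              + alpha0 ^+ 2 / (2 * gamma0) * enorm (x 1%N - xs) ^+ 2) in
  let S := dom_ball P xs (Num.sqrt (2 * gamma0) * r0 / alpha0) in
  let Shat := dom_ball P xs
    ((1 + gamma0 * LS) * Num.sqrt (2 * gamma0) * r0 / alpha0) in
  proper_closed_convex f ->
  proper_closed_convex P ->
  (forall u, closure (edom P) u -> ediff f u) ->
  locally_lipschitz_grad f (closure (edom P)) ->
  F xs \is a fin_num ->
  is_argmin F xs ->
  0 <= mu ->
  convexity_parameter f mu (edom P) ->
  0 < gamma0 ->
  (0 < mu -> gamma0 <= mu^-1) ->
  0 < alpha0 ->
  Num.sqrt (mu * gamma0) <= alpha0 <= 1 ->
  0 < delta < 1 ->
  generated f P mu gamma0 alpha0 delta nn gamma alpha beta x y z ->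
  0 < LS ->
  lipschitz_grad f LS S ->
  0 < LShat ->
  lipschitz_grad f LShat Shat ->
  forall t : nat, (1 <= t)%N ->
    (F (x t) - F xs <=
      (Num.min
         ((1 - Num.sqrt (mu * Num.min gamma0 (delta * LShat^-1))) ^+ (t - 1))
         (4 * (2 + (t - 1)%:R * alpha0 *
                 Num.sqrt (Num.min 1 (delta * gamma0^-1 * LShat^-1))) ^- 2)
       * r0 ^+ 2)%:E)%E.
Proof.
move=> F r0 ? ? _ P_pcc f_diff f_lip Fxs xs_min mu0 f_mu g0 _ a0 /andP[sa _].
move=> d01 gen LS0 lipS LShat0 lipShat [//|t] _.
have Dxs : edom P xs.
  have [[Pgt _] _ _] := P_pcc; rewrite /edom /= ltey.
  by move: Fxs; rewrite fin_numD => /andP[_]; rewrite fin_numE => /andP[].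
have FE u : edom P u -> F u = ((fine \o f) u + (fine \o P) u)%:E.
  by move=> Du; rewrite /F (edom_finef f_diff Du) (edom_fineP P_pcc Du) EFinD.
have mua : mu * gamma0 <= alpha0 ^+ 2.
  rewrite -[leLHS]sqr_sqrtr ?mulr_ge0 ?(ltW g0) //.
  by rewrite ler_pXn2r ?nnegrE ?sqrtr_ge0 // ltW.
have Dx1 := gen_dom gen.
have r0E : gap f P xs (x 1%N)
    + alpha0 ^+ 2 / gamma0 / 2 * enorm (x 1%N - xs) ^+ 2 = r0 ^+ 2.
  rewrite /r0 (FE _ Dx1) (FE _ Dxs) /= sqr_sqrtr.
    by congr (_ + _ * _); field; rewrite gt_eqF.
  rewrite addr_ge0 ?(gap_ge0 P_pcc f_diff Dxs xs_min Dx1) //.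
  by rewrite mulr_ge0 ?sqr_ge0 // divr_ge0 ?sqr_ge0 ?mulr_ge0 // ltW.
pose rho := Num.sqrt (2 * gamma0) * r0 / alpha0.
have rho0 : 0 <= rho by rewrite !mulr_ge0 ?sqrtr_ge0 ?invr_ge0 // ltW.
have rhoE : rho ^+ 2 = 2 * r0 ^+ 2 / (alpha0 ^+ 2 / gamma0).
  rewrite /rho !exprMn sqr_sqrtr; last by rewrite mulr_ge0 // ltW.
  by field; rewrite !gt_eqF.
have {}lipShat :
    lipschitz_grad f LShat (dom_ball P xs ((1 + gamma0 * LS) * rho)).
  by rewrite /rho !mulrA.
have [Dx rate] := gap_rate P_pcc f_diff f_lip Dxs xs_min mu0 f_mu g0 d01 rho0
  LS0 lipS LShat0 lipShat a0 mua gen r0E rhoE t.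
by rewrite (FE _ Dx) (FE _ Dxs) -EFinB lee_fin subn1.
Qed.
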